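(* There is an absolute constant $C>0$ such that the following holds. If $q=p^{2r}$ where $p$ is an odd prime and $r\ge 1$ is an integer, then \[ \chi(ER_q)\le 2\sqrt{q}+C\frac{\sqrt{q}}{\log q}. \]
   Context: For a prime power $q$, the Erdős–Rényi orthogonal polarity graph $ER_q$ is the graph whose vertices are the points of the projective plane $PG(2,q)$, i.e. the $1$-dimensional subspaces of $\mathbb{F}_q^3$, where distinct vertices $(x_0,x_1,x_2)$ and $(y_0,y_1,y_2)$ (written in homogeneous coordinates) are adjacent if and only if $x_0y_0+x_1y_1+x_2y_2=0$. (Equivalently, up to isomorphism, adjacency can be given by $x_2y_0+x_0y_2=x_1y_1$.) $\chi$ denotes the chromatic number. *)

(* Defs.v *)
From Stdlib Require Import Reals.
From HB Require Import structures.
From mathcomp Require Import all_boot all_order all_algebra all_field.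
Set Implicit Arguments. Unset Strict Implicit. Unset Printing Implicit Defensive.
Import GRing.Theory.

Section Chromatic.
Variables (T : finType) (e : rel T).

Definition colorableb (k : nat) : bool :=
  [exists f : {ffun T -> 'I_k}, [forall x, forall y, e x y ==> (f x != f y)]].

(* for irreflexive e, #|T| colours suffice; in general we take the least k with a
   proper colouring, and 0 if none exists (only possible for graphs with loops). *)
Definition colorable_or_loop (k : nat) : bool := colorableb k || [exists x, e x x].

Lemma colorable_or_loop_ex : exists k, colorable_or_loop k.
Proof.
exists #|T|; apply/orP.
case: (boolP [exists x, e x x]) => [H|/existsPn noloop]; first by right.
left; apply/existsP; exists [ffun x => enum_rank x].
apply/forallP => x; apply/forallP => y; apply/implyP => exy.
rewrite !ffunE; apply/negP => /eqP /enum_rank_inj exy'.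
by move: (noloop x); rewrite {2}exy' exy.
Qed.

Definition chromatic_number : nat := ex_minn colorable_or_loop_ex.
End Chromatic.

Local Open Scope ring_scope.
(* A point of PG(2,F) (a 1-dimensional subspace of F^3) is represented by its unique
   normalized homogeneous coordinate vector: nonzero, with first nonzero coordinate 1. *)
Definition normalized (F : finFieldType) (u : 'rV[F]_3) : bool :=
  [exists i : 'I_3, (u 0 i == 1) && [forall j : 'I_3, (j < i)%N ==> (u 0 j == 0)]].

Definition PG2 (F : finFieldType) := {u : 'rV[F]_3 | normalized u}.

Definition ER_adj (F : finFieldType) : rel (PG2 F) :=
  fun x y => (x != y) && (\sum_(i < 3) (val x) 0 i * (val y) 0 i == 0).

Definition chi_ER (F : finFieldType) : nat := chromatic_number (@ER_adj F).

(* Main.v *)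
(** Write q = s^2, F = F_q = E + E th with E = F_s and th^2 = m in E.  As -1 is a square in F, the
polarity is equivalent to X0 Y2 + X2 Y0 = X1 Y1, and the affine points (1, x, y), (1, x', y') are
adjacent iff y + y' = x x'.  Put x = a + t th and y = b + d th.  Colouring the points with
d <> t a by t and by the "sign" of d - t a is proper and uses 2 s colours;
two more colours suffice for the points with X0 = 0.

On the remaining s^3 points, put beta = a^2 + m t^2 - 2 b: there, adjacency means
t = t' and beta + beta' = (a - a')^2, or a = a' and beta + beta' = m (t - t')^2.  Cut E into about
s / l cells i(a), in such a way that squares of differences within a cell lie in a sparse set D:
the cells are cosets of an F_p-subspace A with D inside A * A, or intervals of length l if s is
prime.  For beta outside a small set Bad, two classes kappa(beta) suffice for the sums
beta + beta' within a class to avoid D.  Since an edge keeps t or a fixed, the colour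
(kappa(beta), kappa(beta / m), i(a) + i(t)) is proper and costs only O(s / l) colours, rather than
(s / l)^2; the bad points span a graph of degree O(|Bad|) and are coloured greedily.  One can take
|Bad| = O(s / l) with log s = O(l). *)

Require Import Defs.
From Stdlib Require Import Reals Lra.
From HB Require Import structures.
From mathcomp Require Import all_boot all_order all_algebra all_field.
From mathcomp Require Import zify ring.
Set Implicit Arguments. Unset Strict Implicit. Unset Printing Implicit Defensive.
Import GRing.Theory.

(** * Colouring bounds for finite graphs *)

Lemma chromatic_number_le (T C : finType) (e : rel T) (f : T -> C) :
  (forall x y, e x y -> f x <> f y) -> chromatic_number e <= #|C|.
Proof.
move=> f_proper; rewrite /chromatic_number; case: ex_minnP => n _; apply.
apply/orP; left; apply/existsP; exists [ffun x => enum_rank (f x)].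
apply/forallP=> x; apply/forallP=> y; apply/implyP=> exy.
by rewrite !ffunE (inj_eq enum_rank_inj); apply/eqP/f_proper.
Qed.

Lemma greedy_coloring (T : finType) (e : rel T) (D : nat) :
  irreflexive e -> symmetric e -> (forall x, #|[set y | e x y]| <= D) ->
  exists f : T -> 'I_D.+1, forall x y, e x y -> f x <> f y.
Proof.
move=> irr_e sym_e deg_e.
suff [f f_proper] : exists f : T -> 'I_D.+1,
    {in enum T &, forall x y, e x y -> f x <> f y}.
  by exists f => x y; apply: f_proper; rewrite mem_enum.
elim: (enum T) => [|x s [f f_proper]]; first by exists (fun=> ord0).
have [sx|s'x] := boolP (x \in s).
  have mem_s y : y \in x :: s -> y \in s by rewrite inE => /predU1P[->|].
  by exists f => y z /mem_s sy /mem_s sz; apply: f_proper.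
(* The at most [D] values of [f] on neighbours of [x], coloured yet or not, leave one of the [D.+1]
   colours free. *)
have [c] : exists c, c \notin f @: [set y | e x y].
  apply/existsP; rewrite -negb_forall; apply/negP => /forallP fT.
  have : #|f @: [set y | e x y]| <= D := leq_trans (leq_imset_card _ _) (deg_e x).
  rewrite (_ : f @: _ = setT) ?cardsT ?card_ord ?ltnn //.
  by apply/setP=> c; rewrite fT inE.
move=> c_new; exists (fun y => if y == x then c else f y) => y z.
have f_nbr u : e x u -> c <> f u.
  by move=> exu cE; case/imsetP: c_new; exists u; rewrite ?inE.
rewrite !inE; case: eqVneq => [->|_]; case: eqVneq => [->|_] //=.
- by rewrite irr_e.
- by move=> _ _ /f_nbr.
- by move=> _ _; rewrite sym_e => /f_nbr cu /esym.
- exact: f_proper.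
Qed.

(** * Cells and classes that keep sums away from squares of differences *)

Local Open Scope ring_scope.

(* Picks one element of each pair {x, - x} with x != - x. *)
Definition half (V : finZmodType) (x : V) : bool :=
  (enum_rank x < enum_rank (- x))%N.

Lemma half_opp (V : finZmodType) (x : V) : x != - x -> half (- x) = ~~ half x.
Proof.
move=> xN; rewrite /half opprK -leqNgt [RHS]leq_eqVlt.
suff /negPf -> : enum_rank (- x) != enum_rank x :> nat by [].
by apply: contra xN => /eqP/ord_inj/enum_rank_inj/esym/eqP.
Qed.

(** [i] numbers the cells and [kappa] gives the two classes. Only edges that keep [t] are modelled;
    those that keep [a] reduce to them on dividing beta by [m]. *)
Definition separated (E : finFieldType) (i : E -> nat) (kappa : E -> bool)
    (Bad : {set E}) : Prop :=
  forall a a' b b', b \notin Bad -> b' \notin Bad -> kappa b = kappa b' ->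
    i a = i a' -> b + b' <> (a - a') ^+ 2.

Lemma two_neq0 (E : finFieldType) : odd #|E| -> 2%:R != 0 :> E.
Proof.
have [p pr_p pE] := finPcharP E.
have oE : #|E| = (p ^ logn p #|E|)%N := card_pprimeChar pE.
rewrite oE oddX => /orP[/eqP n0|].
  by have := finNzRing_gt1 E; rewrite oE n0.
by rewrite -(dvdn_pcharf pE) dvdn_prime2 //; case: eqP => // ->.
Qed.

Lemma neq_opp (E : finFieldType) (x : E) : odd #|E| -> x != 0 -> x != - x.
Proof.
move=> /two_neq0 E2 x0; rewrite -subr_eq0 opprK -mulr2n -mulr_natl.
by rewrite mulf_neq0.
Qed.

Lemma exists_vspace_dim (K : fieldType) (V : vectType K) (d : nat) :
  (d <= \dim {:V})%N -> exists A : {vspace V}, \dim A = d.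
Proof.
move=> le_d; exists <<take d (vbasis {:V})>>%VS.
have: free (take d (vbasis {:V}) ++ drop d (vbasis {:V})).
  by rewrite cat_take_drop (basis_free (vbasisP _)).
by move/catl_free/eqP=> ->; rewrite size_takel // size_tuple.
Qed.

(** Cells are the cosets of a subspace [A] of dimension [d], and [Bad] is [U = A * A], of dimension
    at most [d * d]. If [a - a'] is in [A], its square is in [U], so [b] and [b'] are opposite
    modulo [U]; being nonzero there, they are told apart by [half]. *)
Lemma separated_subspace (E : finFieldType) (p r d : nat) :
  prime p -> odd p -> #|E| = (p ^ r)%N -> (d <= r)%N ->
  exists (i : E -> nat) (kappa : E -> bool) (Bad : {set E}),
    [/\ forall a, (i a < p ^ (r - d))%N, (#|Bad| <= p ^ (d * d))%N
      & separated i kappa Bad].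
Proof.
move=> pr_p odd_p oE le_d.
have oddE : odd #|E| by rewrite oE oddX odd_p orbT.
have pE := card_finPcharP oE pr_p.
pose L : splittingFieldType 'F_p := pPrimeCharType pE.
pose fL : finFieldType := pPrimeCharType pE.
have dimL : \dim {:L} = r.
  apply/eqP; rewrite -(eqn_exp2l _ _ (prime_gt1 pr_p)) -oE.
  have := @card_vspacef _ fL (Vector.class (pPrimeCharType pE)).
  by rewrite card_vspace card_Fp // => ->.
have cardV (V : {vspace L}) : #|[set x : fL | x \in V]| = (p ^ \dim V)%N.
  by rewrite cardsE (@card_vspace _ fL (Vector.class (pPrimeCharType pE))) card_Fp.
have [A dimA] : exists A : {vspace L}, \dim A = d.
  by apply: exists_vspace_dim; rewrite dimL.
pose U := (A * A)%VS.
(* [res V] is the linear projection with kernel [V] onto a fixed complement: a canonical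
   representative of the coset. *)
pose res (V : {vspace L}) (x : L) : L := x - projv V x.
have res_eq0 V x : res V x = 0 -> x \in V.
  by move/eqP; rewrite subr_eq0 => /eqP ->; apply: memv_proj.
have resB V x y : res V (x - y) = res V x - res V y.
  by rewrite /res linearB; ring.
have resD V x y : res V (x + y) = res V x + res V y.
  by rewrite /res linearD; ring.
pose AC := enum [set x : fL | x \in (A^C)%VS].
exists (fun a => index (res A a : fL) AC), (fun b => half (res U b : E)),
  [set x : fL | x \in U].
have memAC a : (res A a : fL) \in AC by rewrite mem_enum inE memv_projC.
split=> [a||a a' b b'].
- have -> : (p ^ (r - d))%N = size AC by rewrite -cardE cardV dimv_compl dimL dimA.
  by rewrite index_mem.
- by rewrite cardV leq_exp2l ?prime_gt1 // -[d in X in (_ <= X)%N]dimA dim_prodv.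
rewrite !inE => Ub Ub' kE iE' sumE.
have iE : res A a = res A a'.
  by rewrite -[LHS](nth_index 0 (memAC a)) iE' nth_index.
have Aa : (a - a' : L) \in A.
  by apply: res_eq0; rewrite resB iE // subrr.
have res0 : res U (b + b') = 0.
  have Us : (b + b' : L) \in U.
    by rewrite [b + b']sumE expr2; apply: memv_mul.
  by rewrite /res projv_id // subrr.
have res_b' : res U b' = - res U b.
  by apply/eqP; rewrite -addr_eq0 addrC -resD res0.
have res_b : (res U b : E) != 0.
  by apply: contra Ub => /eqP/res_eq0.
move: kE; rewrite res_b' half_opp ?(neq_opp oddE res_b) //.
by case: (half _).
Qed.

Lemma natr_inj_mod (R : nzRingType) (p m n : nat) :
  p \in [pchar R] -> m%:R = n%:R :> R -> m = n %[mod p].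
Proof.
move=> pR; wlog le_nm : m n / (n <= m)%N => [IH mn|].
  by have [/IH|/ltnW/IH/(_ (esym mn))] := leqP n m; first apply.
by move=> mn; apply/eqP; rewrite eqn_mod_dvd // (dvdn_pcharf pR) natrB // mn subrr.
Qed.

(** Cells are intervals of [l] residues, so squares of differences within a cell are integers below
    [L = l * l]. [kappa] says whether a residue is below p/2. Two good residues of the same class
    have a sum that reduces modulo [p] to an integer strictly between [L] and [p], hence not to such
    a square. *)
Lemma separated_interval (E : finFieldType) (p l : nat) :
  prime p -> odd p -> #|E| = p -> (0 < l)%N -> (l * l <= p)%N ->
  exists (i : E -> nat) (kappa : E -> bool) (Bad : {set E}),
    [/\ forall a, (i a < (p %/ l).+1)%N, (#|Bad| <= 4 * (l * l))%N
      & separated i kappa Bad].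
Proof.
move=> pr_p odd_p oE l_gt0 le_l.
have p_gt0 := prime_gt0 pr_p.
have pE : p \in [pchar E] by apply: (@card_finPcharP E p 1).
have natr_inj : injective (fun n : 'I_p => n%:R : E).
  by move=> m n /(natr_inj_mod pE); rewrite !modn_small // => /ord_inj.
have [rep _ repK] : bijective (fun n : 'I_p => n%:R : E).
  by apply: inj_card_bij => //; rewrite oE card_ord.
pose L := (l * l)%N.
exists (fun a => rep a %/ l)%N, (fun b => rep b * 2 < p)%N,
  [set b | (rep b * 2 <= L) || (p <= rep b * 2 <= p + L)]%N.
split=> [a||a a' b b'].
- by rewrite ltnS leq_div2r // ltnW.
(* The bad residues lie in two runs of length [L.+1], starting at 0 and at [uphalf p], and 2 (L + 1)
   <= 4 L. *)
- pose g (x : 'I_L.+1 * bool) : E := (x.1 + x.2 * uphalf p)%:R.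
  apply: (@leq_trans #|g @: setT|); last first.
    rewrite (leq_trans (leq_imset_card _ _)) // cardsT card_prod card_ord card_bool.
    by rewrite -/L; have : (0 < L)%N; [rewrite muln_gt0 l_gt0 | lia].
  apply/subset_leq_card/subsetP => b; rewrite inE => b_bad.
  have [b_small|b_big] := leqP (rep b * 2) L.
    have lt_b : (rep b < L.+1)%N by lia.
    by apply/imsetP; exists (Ordinal lt_b, false); rewrite ?inE // /g addn0 repK.
  have lt_b : (rep b - uphalf p < L.+1)%N by lia.
  apply/imsetP; exists (Ordinal lt_b, true); rewrite ?inE // /g mul1n /=.
  by rewrite subnK ?repK //; lia.
rewrite !inE => Bb Bb' kE iE sumE.
wlog le_a : a a' iE sumE / (rep a' <= rep a)%N => [IH|].
  have [|/ltnW] := leqP (rep a') (rep a); first exact: IH iE sumE.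
  by apply: (IH a' a) => //; rewrite sumE -[RHS]sqrrN opprB.
pose k := (rep a - rep a')%N.
have lt_k : (k * k < L)%N.
  suff lt_kl : (k < l)%N by rewrite /L; nia.
  rewrite /k (divn_eq (rep a) l) (divn_eq (rep a') l) iE subnDl.
  by rewrite (leq_ltn_trans (leq_subr _ _)) ?ltn_pmod.
have : (rep b + rep b')%:R = (k * k)%:R :> E.
  by rewrite natrD natrM natrB // !repK sumE expr2.
move/(natr_inj_mod pE); rewrite [RHS]modn_small; last exact: leq_trans le_l.
have [b_lt|b_ge] := ltnP (rep b * 2) p.
  by rewrite modn_small; lia.
have rb := ltn_ord (rep b); have rb' := ltn_ord (rep b').
rewrite -[(rep b + _)%N](@subnK p); last by lia.
by rewrite modnDr modn_small; lia.
Qed.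

(** For r = 1, intervals with [l] the integer cube root of [p] give l |Bad| <= 4 l^3 <= 4 p. For r >
    1, subspaces with [d] maximal such that d^2 + d <= r give l = p^d and l |Bad| <= p^(d + d^2) <=
    p^r; such a d > 0 exists only when r >= 2, whence the two cases. *)
Lemma separated_exists (E : finFieldType) (p r : nat) :
  prime p -> odd p -> (0 < r)%N -> #|E| = (p ^ r)%N ->
  exists (l K : nat) (i : E -> nat) (kappa : E -> bool) (Bad : {set E}),
    [/\ (0 < l <= #|E|)%N /\ (#|E| <= 2 ^ (6 * l))%N,
        (forall a, i a < K)%N, (l * K <= 4 * #|E|)%N, (l * #|Bad| <= 4 * #|E|)%N
      & separated i kappa Bad].
Proof.
move=> pr_p odd_p r_gt0 oE.
have p_gt0 := prime_gt0 pr_p; have p_gt1 := prime_gt1 pr_p.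
have p_ge3 : (3 <= p)%N by rewrite odd_prime_gt2.
have [r1|r_gt1] := leqP r 1.
  have {r1 r_gt0} r1 : r = 1 by apply/eqP; rewrite eqn_leq r1.
  rewrite r1 expn1 in oE.
  have cube_le l : (l ^ 3 <= p)%N -> (l <= p)%N.
    by case: l => // l; apply: leq_trans; rewrite -[X in (X <= _)%N]expn1 leq_pexp2l.
  have [|l le_l max_l] := ex_maxnP _ cube_le; first by exists 1.
  have l_gt0 : (0 < l)%N by apply: max_l; rewrite exp1n.
  have lt_p : (p < l.+1 ^ 3)%N.
    by rewrite ltnNge; apply/negP => /max_l; rewrite ltnn.
  have le_l2 : (l * l * l <= p)%N by move: le_l; rewrite !expnS expn0; lia.
  have [|i [kappa [Bad [i_lt oBad sep]]]] := separated_interval pr_p odd_p oE l_gt0.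
    by apply: leq_trans le_l2; rewrite leq_pmulr.
  exists l, (p %/ l).+1, i, kappa, Bad; rewrite oE l_gt0 cube_le //; split=> //.
  - split=> //; apply: leq_trans (ltnW lt_p) _.
    apply: (@leq_trans ((2 ^ l) ^ 3)); first by rewrite leq_exp2r // ltn_expl.
    by rewrite -expnM leq_exp2l // mulnC leq_mul2r orbT.
  - have := leq_trunc_div p l; have := cube_le l le_l.
    by rewrite mulnS mulnC; lia.
  - by apply: (@leq_trans (l * (4 * (l * l)))); [rewrite leq_mul2l oBad orbT | lia].
have le_d d : (d * d + d <= r)%N -> (d <= r)%N by move=> le_r; lia.
have [|d d_le max_d] := ex_maxnP _ le_d; first by exists 1.
have d_gt0 : (0 < d)%N by apply: max_d.
have r_lt : (r < d.+1 * d.+1 + d.+1)%N.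
  by rewrite ltnNge; apply/negP => /max_d; rewrite ltnn.
have [i [kappa [Bad [i_lt oBad sep]]]] :=
  separated_subspace pr_p odd_p oE (le_d d d_le).
exists (p ^ d)%N, (p ^ (r - d))%N, i, kappa, Bad.
(* By maximality r < (d + 1)^2 + (d + 1), which is 6 at d = 1 and grows by a factor of at most 3 <=
   p at each step. Then p^r <= 2^(p r) <= 2^(6 p^d). *)
have r_le : (r <= 6 * p ^ d.-1)%N.
  have quad_le n : (n.+2 * n.+2 + n.+2 <= 6 * p ^ n)%N.
    elim: n => [|n IHn] //; rewrite expnS.
    by apply: (@leq_trans (3 * (6 * p ^ n))); [lia | nia].
  by apply: leq_trans (ltnW r_lt) _; have := quad_le d.-1; rewrite prednK.
split=> //.
- split; first by rewrite expn_gt0 p_gt0 oE leq_exp2l // le_d.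
  rewrite oE; apply: (@leq_trans ((2 ^ p) ^ r)).
    by rewrite leq_exp2r // ltnW // ltn_expl.
  rewrite -expnM leq_exp2l // -(prednK d_gt0) expnS.
  by rewrite (mulnCA 6) leq_mul2l r_le orbT.
- have -> : (p ^ d * p ^ (r - d))%N = #|E| by rewrite oE -expnD subnKC // le_d.
  exact: leq_pmull.
- apply: (@leq_trans (p ^ d * p ^ (d * d))); first by rewrite leq_mul2l oBad orbT.
  apply: (@leq_trans #|E|); last exact: leq_pmull.
  by rewrite oE -expnD leq_exp2l // addnC.
Qed.

(** * Colouring the points with d = t a *)

(** Recovers a difference from its square and one sign bit, to count the neighbours of a bad point.
    The default 0 is never taken at a square. *)
Lemma sqr_root_ex (F : finFieldType) :
  exists rho : F -> F, forall x, exists eps : bool, x = (-1) ^+ eps * rho (x ^+ 2).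
Proof.
exists (fun c => odflt 0 [pick y | y ^+ 2 == c]) => x.
case: pickP => [y /=|/(_ x)]; last by rewrite eqxx.
rewrite eqf_sqr => /orP[/eqP ->|/eqP ->].
  by exists false; rewrite expr0 mul1r.
by exists true; rewrite expr1 mulN1r opprK.
Qed.

(** A triple is (a, t, beta): the variable [b] stands for beta here. *)
Lemma residual_coloring (E : finFieldType) (m : E) (K : nat) (i : E -> nat)
    (kappa : E -> bool) (Bad : {set E}) :
  m != 0 -> (forall a, i a < K)%N -> separated i kappa Bad ->
  exists (C : finType) (h : E * E * E -> C),
    (#|C| <= 8 * K + 8 * #|Bad| + 5)%N /\
    forall a t b a' t' b', (a, t, b) != (a', t', b') ->
      (t = t' /\ b + b' = (a - a') ^+ 2) \/ (a = a' /\ b + b' = m * (t - t') ^+ 2) ->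
      h (a, t, b) <> h (a', t', b').
Proof.
move=> m0 i_lt sep.
have i2_lt x y : (i x + i y < (K + K).+1)%N.
  by rewrite ltnS; apply: leq_add; apply: ltnW.
pose V := (E * E * E)%type.
(* Outside [Bad2], both beta and beta / m avoid [Bad]. *)
pose Bad2 := Bad :|: [set m * b | b in Bad].
have oBad2 : (#|Bad2| <= 2 * #|Bad|)%N.
  rewrite (leq_trans (leq_card_setU _ _)) // mul2n -addnn leq_add2l.
  exact: leq_imset_card.
pose H (v w : V) := ((v.1.2 == w.1.2) && (v.2 + w.2 == (v.1.1 - w.1.1) ^+ 2))
  || ((v.1.1 == w.1.1) && (v.2 + w.2 == m * (v.1.2 - w.1.2) ^+ 2)).
pose e (v w : V) := [&& v != w, v.2 \in Bad2, w.2 \in Bad2 & H v w].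
have irr_e : irreflexive e by move=> v; rewrite /e eqxx.
have sym_H v w : H v w = H w v.
  have sqr_swap (x y : E) : (x - y) ^+ 2 = (y - x) ^+ 2 by ring.
  rewrite /H (eq_sym v.1.2) (eq_sym v.1.1) (addrC v.2).
  by rewrite (sqr_swap v.1.1) (sqr_swap v.1.2).
have sym_e : symmetric e by move=> v w; rewrite /e eq_sym sym_H [(v.2 \in _) && _]andbCA.
have [rho rhoE] := sqr_root_ex E.
have deg_e v : (#|[set w | e v w]| <= 8 * #|Bad|)%N.
  case: v => -[a t] b.
  (* A neighbour is determined by its own beta, the kind of edge and a sign, so there are at most 4
     |Bad2| <= 8 |Bad| neighbours. *)
  pose g (x : E * (bool * bool)) : V :=
    if x.2.1 then (a - (-1) ^+ x.2.2 * rho (b + x.1), t, x.1)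
    else (a, t - (-1) ^+ x.2.2 * rho ((b + x.1) / m), x.1).
  apply: (@leq_trans #|g @: setX Bad2 setT|); last first.
    rewrite (leq_trans (leq_imset_card _ _)) // cardsX cardsT card_prod card_bool.
    by rewrite mulnC; lia.
  apply/subset_leq_card/subsetP => -[[a' t'] b'].
  rewrite inE /e /H /= => /and4P[_ _ Bb' /orP[|] /andP[/eqP <- /eqP bE]].
    have [eps epsE] := rhoE (a - a').
    apply/imsetP; exists (b', (true, eps)); first by rewrite in_setX Bb' inE.
    by rewrite /g /= bE -epsE subKr.
  have [eps epsE] := rhoE (t - t').
  apply/imsetP; exists (b', (false, eps)); first by rewrite in_setX Bb' inE.
  by rewrite /g /= bE mulrAC divff // mul1r -epsE subKr.
have [f f_proper] := greedy_coloring irr_e sym_e deg_e.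
(* The colours number 4 (2 K + 1) + 8 |Bad| + 1. As an edge keeps [a] or [t], equal sums of cell
   indices give equal cells for the other coordinate. *)
exists ((bool * bool * 'I_(K + K).+1) + 'I_(8 * #|Bad|).+1)%type.
exists (fun v : V => if v.2 \in Bad2 then inr (f v)
  else inl (kappa v.2, kappa (v.2 / m), inord (i v.1.1 + i v.1.2))).
split; first by rewrite card_sum !card_prod !card_bool !card_ord; lia.
move=> a t b a' t' b' neq_v adj /=.
have [Bb|Bb] := boolP (b \in Bad2); have [Bb'|Bb'] := boolP (b' \in Bad2) => //.
  case; apply: f_proper; rewrite /e neq_v Bb Bb' /H /=.
  by case: adj => -[-> ->]; rewrite !eqxx ?orbT.
have notBad x : x \notin Bad2 -> x \notin Bad /\ x / m \notin Bad.
  rewrite inE negb_or => /andP[-> xm]; split=> //.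
  by apply: contra xm => xm; apply/imsetP; exists (x / m); rewrite // mulrC divfK.
have [b1 b2] := notBad _ Bb; have [b1' b2'] := notBad _ Bb'.
case=> k1 k2 /(congr1 val); rewrite !val_insubd.
rewrite !i2_lt => iE; case: adj => -[eq_v bE]; subst.
  by move/addIn: iE => iE; apply: sep bE.
move/addnI: iE => iE; apply: sep b2 b2' k2 iE _.
by rewrite -mulrDl bE mulrAC divff // mul1r.
Qed.

(** * The quadratic extension F / E and a square root of -1 *)

Section FrobeniusFixedField.
Variables (F : finFieldType) (s : nat).

(** The argument [sN] makes [s] a power of the characteristic, so that x -> x^s is additive and the
    subfield instances can attach to this predicate. *)
Definition fix_pow of [pchar F].-nat s := fun x : F => x ^+ s == x.

Lemma fix_pow_divring_closed (sN : [pchar F].-nat s) : divring_closed (fix_pow sN).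
Proof.
split=> [|x y /eqP xE /eqP yE|x y /eqP xE /eqP yE]; apply/eqP.
- by rewrite expr1n.
- by rewrite exprDn_pchar // exprNn_pchar // xE yE.
- by rewrite expr_div_n xE yE.
Qed.

Definition fix_field (sN : [pchar F].-nat s) : predArgType := {x : F | fix_pow sN x}.

HB.instance Definition _ sN :=
  GRing.isDivringClosed.Build F (fix_pow sN) (fix_pow_divring_closed sN).
HB.instance Definition _ sN := SubFinite.on (fix_field sN).
HB.instance Definition _ sN := [SubChoice_isSubIntegralDomain of fix_field sN by <:].
HB.instance Definition _ sN := [SubIntegralDomain_isSubField of fix_field sN by <:].
End FrobeniusFixedField.

Lemma nonroot_ex (F : finFieldType) (f : {poly F}) :
  f != 0 -> (size f <= #|F|)%N -> exists x, f.[x] != 0.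
Proof.
move=> f0 size_f; apply/existsP; rewrite -negb_forall; apply/negP => /forallP f_eq0.
have: (size (enum F) < size f)%N.
  by apply: max_poly_roots; rewrite ?enum_uniq //; apply/allP => x _; apply: f_eq0.
by rewrite -cardE ltnNge size_f.
Qed.

(** Here |F| = 4 k + 1. A non-root [x] of X (X^(2 k) - 1) has x^(4 k) = 1 and x^(2 k) <> 1, so x^k
    squares to -1. *)
Lemma sqrt_opp1_ex (F : finFieldType) (s : nat) :
  odd s -> (1 < s)%N -> #|F| = (s * s)%N -> exists i : F, i ^+ 2 = -1.
Proof.
move=> odd_s s_gt1 oF.
have [k oFk] : exists k, #|F| = (4 * k).+1.
  exists (s./2 * s./2 + s./2)%N; rewrite oF -[in LHS](odd_double_half s) odd_s -mul2n.
  by lia.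
have k_gt0 : (0 < k)%N by have := finNzRing_gt1 F; rewrite oFk; lia.
have size_k : size ('X^(2 * k) - 1 : {poly F}) = (2 * k).+1.
  by rewrite size_XnsubC // muln_gt0.
have f0 : 'X * ('X^(2 * k) - 1) != 0 :> {poly F}.
  by rewrite mulf_neq0 ?polyX_eq0 // -size_poly_eq0 size_k.
have [|x] := nonroot_ex f0.
  by rewrite mulrC size_mulX -?size_poly_eq0 size_k // oFk; lia.
rewrite !hornerE mulf_eq0 negb_or subr_eq0 => /andP[x0 xk].
exists (x ^+ k); apply/eqP; rewrite -exprM mulnC.
suff : (x ^+ (2 * k)) ^+ 2 == 1 by rewrite sqrf_eq1 (negPf xk).
rewrite -exprM; apply/eqP/(mulfI x0); rewrite -exprS mulr1 -[RHS]expf_card oFk.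
by congr (_ ^+ _); lia.
Qed.

(** [E] is the fixed field of the involution x -> x^s with s = p^r, and [th] is an element that it
    negates; [re] and [im] come from the half sum and half difference of x and x^s. *)
Lemma quadratic_subfield (F : finFieldType) (p r : nat) :
  prime p -> odd p -> (0 < r)%N -> #|F| = (p ^ (2 * r))%N ->
  exists (E : finFieldType) (iota : {rmorphism E -> F}) (m : E) (th : F)
      (re im : F -> E),
    [/\ #|E| = (p ^ r)%N, m != 0, th ^+ 2 = iota m,
        forall x, x = iota (re x) + iota (im x) * th
      & forall a t a' t', iota a + iota t * th = iota a' + iota t' * th ->
          a = a' /\ t = t'].
Proof.
move=> pr_p odd_p r_gt0 oF; pose s := (p ^ r)%N.
have pF := card_finPcharP oF pr_p.
have oF2 : #|F| = (s * s)%N by rewrite oF mul2n -addnn expnD.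
have F2 : 2%:R != 0 :> F by apply: two_neq0; rewrite oF oddX odd_p orbT.
have sN : [pchar F].-nat s.
  by rewrite /s pnatX; apply/orP; left; rewrite pnatE.
have s_gt1 : (1 < s)%N by rewrite -(exp1n r) ltn_exp2r // prime_gt1.
have conjD (x y : F) : (x + y) ^+ s = x ^+ s + y ^+ s by apply: exprDn_pchar.
have conjN (x : F) : (- x) ^+ s = - x ^+ s by apply: exprNn_pchar.
have conjK (x : F) : x ^+ s ^+ s = x by rewrite -exprM -oF2 expf_card.
have conj2 : 2%:R ^+ s = 2%:R :> F by rewrite conjD expr1n.
(* X^s - X has degree s < |F|, so some [x] is moved by the involution, and x^s - x is negated. *)
have [th th0 thC] : exists2 th : F, th != 0 & th ^+ s = - th.
  have size_s : size ('X^s - 'X : {poly F}) = s.+1.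
    by rewrite size_polyDl ?size_polyXn // size_polyN size_polyX ltnS.
  have [||x] := @nonroot_ex F ('X^s - 'X).
  - by rewrite -size_poly_eq0 size_s.
  - by rewrite size_s oF2; nia.
  rewrite !hornerE => x_s; exists (x ^+ s - x) => //.
  by rewrite conjD conjN conjK opprB.
pose E : finFieldType := fix_field sN; pose iota : {rmorphism E -> F} := \val.
have iotaC (a : E) : iota a ^+ s = iota a by apply/eqP/(valP a).
have iota_ex (x : F) : x ^+ s = x -> {a : E | iota a = x}.
  by move/eqP=> xE; exists (exist _ x xE).
have [m mE] : {m : E | iota m = th ^+ 2} by apply: iota_ex; rewrite exprAC thC sqrrN.
have re_ex x : {a : E | iota a = (x + x ^+ s) / 2%:R}.
  by apply: iota_ex; rewrite expr_div_n conjD conjK conj2 addrC.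
have im_ex x : {a : E | iota a = (x - x ^+ s) / (2%:R * th)}.
  apply: iota_ex; rewrite expr_div_n conjD conjN conjK exprMn conj2 thC.
  by rewrite mulrN invrN mulrN -mulNr opprB.
have uniq_coord a t a' t' : iota a + iota t * th = iota a' + iota t' * th ->
    a = a' /\ t = t'.
  move=> eq1; have /(congr1 (fun x : F => x ^+ s)) := eq1.
  rewrite !conjD !exprMn !iotaC thC !mulrN => eq2.
  have a_eq : a = a'.
    apply/(fmorph_inj iota)/(mulfI F2); rewrite !mulr_natl !mulr2n.
    have := congr2 +%R eq1 eq2.
    by rewrite addrACA [RHS]addrACA !subrr !addr0.
  split=> //; move: eq1; rewrite a_eq => /addrI /(mulIf th0).
  exact: fmorph_inj.
have coordE x : x = iota (sval (re_ex x)) + iota (sval (im_ex x)) * th.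
  case: re_ex im_ex => a /= -> [] t /= ->.
  by field; rewrite th0 F2.
exists E, iota, m, th, (fun x => sval (re_ex x)), (fun x => sval (im_ex x)).
split=> //.
(* Coordinates biject E x E with F, so |E|^2 = s^2. *)
- apply/eqP; rewrite -(eqn_exp2r _ _ (isT : (0 < 2)%N)) -/s -!mulnn -oF2 -card_prod.
  apply/eqP/(@bij_eq_card _ _ (fun v : E * E => iota v.1 + iota v.2 * th)).
  exists (fun x => (sval (re_ex x), sval (im_ex x))).
    by case=> a t /=; have [<- <-] := uniq_coord _ _ _ _ (coordE (iota a + iota t * th)).
  by move=> x; rewrite -coordE.
- by apply: contraNneq th0 => m0; rewrite -sqrf_eq0 -mE m0 rmorph0.
Qed.

(** * Coordinates on the plane adapted to the polarity *)

Lemma big_I3 (V : nmodType) (f : 'I_3 -> V) : \sum_(k < 3) f k = f 0 + f 1 + f 2%:R.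
Proof.
rewrite !big_ord_recl big_ord0 addr0 addrA.
by congr (f _ + f _ + f _); apply: val_inj.
Qed.

Lemma I3_ind (P : 'I_3 -> Prop) : P 0 -> P 1 -> P 2%:R -> forall k, P k.
Proof.
move=> P0 P1 P2 [[|[|[|//]]] lt_k].
- by rewrite (_ : Ordinal _ = 0) //; apply: val_inj.
- by rewrite (_ : Ordinal _ = 1) //; apply: val_inj.
- by rewrite (_ : Ordinal _ = 2%:R) //; apply: val_inj.
Qed.

(** The two leading ones must stand at the same index, where [c] is read off. Hence proportional
    points are equal. *)
Lemma normalized_scale (F : finFieldType) (c : F) (u : 'rV[F]_3) :
  normalized u -> normalized (c *: u) -> c = 1.
Proof.
move=> /existsP[k /andP[/eqP uk /forallP u0]] /existsP[j /andP[/eqP cuj /forallP cu0]].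
rewrite mxE in cuj.
have [lt_kj|lt_jk|/ord_inj eq_kj] := ltngtP k j.
- have := cu0 k; rewrite lt_kj mxE uk mulr1 => /eqP c0.
  by move: cuj; rewrite c0 mul0r => /eqP; rewrite eq_sym oner_eq0.
- have := u0 j; rewrite lt_jk => /eqP uj0.
  by move: cuj; rewrite uj0 mulr0 => /eqP; rewrite eq_sym oner_eq0.
- by move: cuj; rewrite -eq_kj uk mulr1.
Qed.

Section HyperbolicCoordinates.
Variables (F : finFieldType) (j : F).
Hypotheses (F2 : 2%:R != 0 :> F) (j2 : j ^+ 2 = -1).
Implicit Types v w : PG2 F.

(** Since j^2 = -1, the form x0 y0 + x1 y1 splits. With the factor -1/2 in [hyp2], X0 Y2 + X2 Y0 -
    X1 Y1 is minus the original bilinear form. *)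
Definition hyp0 v : F := val v 0 0 + j * val v 0 1.
Definition hyp1 v : F := val v 0 2%:R.
Definition hyp2 v : F := - (val v 0 0 - j * val v 0 1) / 2%:R.

Lemma ER_adj_hyp v w :
  ER_adj v w -> v != w /\ hyp0 v * hyp2 w + hyp2 v * hyp0 w = hyp1 v * hyp1 w.
Proof.
case/andP=> neq_vw; rewrite big_I3 => /eqP sum0; split=> //.
rewrite -[RHS]subr0 -{}sum0 /hyp0 /hyp1 /hyp2.
have j2' : j * j = -1 by rewrite -expr2.
field : j2'.
exact: F2.
Qed.

Lemma hyp_proportional c v w :
  hyp0 v = c * hyp0 w -> hyp1 v = c * hyp1 w -> hyp2 v = c * hyp2 w -> v = w.
Proof.
move=> e0 e1 e2.
have j0 : j != 0 by rewrite -sqrf_eq0 j2 oppr_eq0 oner_eq0.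
have v0 : val v 0 0 = c * val w 0 0.
  have -> : val v 0 0 = hyp0 v / 2%:R - hyp2 v by rewrite /hyp0 /hyp2; field.
  by rewrite e0 e2 /hyp0 /hyp2; field.
have v1 : val v 0 1 = c * val w 0 1.
  have -> : val v 0 1 = (hyp0 v / 2%:R + hyp2 v) / j.
    by rewrite /hyp0 /hyp2; field; rewrite j0 F2.
  by rewrite e0 e2 /hyp0 /hyp2; field; rewrite j0 F2.
have vE : val v = c *: val w.
  by apply/rowP; apply: I3_ind; rewrite mxE.
apply: val_inj; rewrite /= vE.
suff -> : c = 1 by rewrite scale1r.
by apply: normalized_scale (valP w) _; rewrite -vE; apply: valP.
Qed.
End HyperbolicCoordinates.

(** * Colouring the whole graph *)

Lemma chi_ER_separated (F E : finFieldType) (K : nat) (i : E -> nat)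
    (kappa : E -> bool) (Bad : {set E}) (iota : {rmorphism E -> F}) (m : E) (j th : F)
    (re im : F -> E) :
  odd #|F| -> odd #|E| -> j ^+ 2 = -1 -> m != 0 -> th ^+ 2 = iota m ->
  (forall x, x = iota (re x) + iota (im x) * th) ->
  (forall a t a' t', iota a + iota t * th = iota a' + iota t' * th ->
     a = a' /\ t = t') ->
  (forall a, i a < K)%N -> separated i kappa Bad ->
  (chi_ER F <= 2 * #|E| + 8 * K + 8 * #|Bad| + 7)%N.
Proof.
move=> oddF oddE j2 m0 thE coordE coord_inj i_lt sep.
have F2 := two_neq0 oddF; have E2 := two_neq0 oddE.
have [C [h [oC h_proper]]] := residual_coloring m0 i_lt sep.
pose X (v : PG2 F) := hyp1 v / hyp0 j v; pose Y (v : PG2 F) := hyp2 j v / hyp0 j v.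
pose a v := re (X v); pose t v := im (X v); pose b v := re (Y v); pose d v := im (Y v).
pose beta v := a v ^+ 2 + m * t v ^+ 2 - 2%:R * b v.
pose color v : C + E * bool + bool :=
  if hyp0 j v == 0 then inr (hyp1 v == 0)
  else if d v == t v * a v then inl (inl (h (a v, t v, beta v)))
  else inl (inr (t v, half (d v - t v * a v))).
apply: (@leq_trans #|{: C + E * bool + bool}|); last first.
  rewrite !card_sum !card_prod !card_bool.
  have arith n c : (8 * K + 8 * c + 5 + n * 2 + 2 <= 2 * n + 8 * K + 8 * c + 7)%N.
    by lia.
  exact: leq_trans (leq_add (leq_add oC (leqnn _)) (leqnn _)) (arith _ _).
apply: (@chromatic_number_le _ _ _ color) => v w /(ER_adj_hyp F2 j2)[neq_vw adj].
have XY_inj : hyp0 j v != 0 -> hyp0 j w != 0 -> a v = a w -> t v = t w ->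
    b v = b w -> d v = d w -> False.
  move=> v0 w0 av tv bv dv.
  have Xv : X v = X w by rewrite (coordE (X v)) -/(a v) av -/(t v) tv -coordE.
  have Yv : Y v = Y w by rewrite (coordE (Y v)) -/(b v) bv -/(d v) dv -coordE.
  case/eqP: neq_vw; apply: (hyp_proportional F2 j2 (c := hyp0 j v / hyp0 j w)).
  - by rewrite divfK.
  - by rewrite mulrAC -mulrA -/(X w) -Xv mulrC divfK.
  - by rewrite mulrAC -mulrA -/(Y w) -Yv mulrC divfK.
rewrite /color; have [v0|v0] := eqVneq (hyp0 j v) 0.
  (* On the line X0 = 0 adjacency means X1 Y1 = 0, so equal colours force both points to be (0, 0,
     1). *)
  have [w0|w0] := eqVneq (hyp0 j w) 0; last by case: ifP.
  case=> v1; move: adj; rewrite v0 w0 mul0r mulr0 addr0 => /esym/eqP.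
  rewrite mulf_eq0 v1 orbb => /eqP w1; move: v1; rewrite w1 eqxx => /eqP v1.
  have [w2|w2] := eqVneq (hyp2 j w) 0; case/eqP: neq_vw.
    (* All coordinates of [w] would vanish; [c = 0] turns this impossible case into w = v. *)
    by apply/esym/(hyp_proportional F2 j2 (c := 0)); rewrite ?v0 ?w0 ?v1 ?w1 ?w2 mul0r.
  apply: (hyp_proportional F2 j2 (c := hyp2 j v / hyp2 j w)).
  + by rewrite v0 w0 mulr0.
  + by rewrite v1 w1 mulr0.
  + by rewrite divfK.
have [w0|w0] := eqVneq (hyp0 j w) 0; first by case: ifP.
have adjXY : Y v + Y w = X v * X w.
  by rewrite /X /Y mulrACA -adj; field; rewrite w0 v0.
(* The two components of y + y' = x x' in the basis 1, [th]. *)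
have [sum_b sum_d] : b v + b w = a v * a w + m * (t v * t w) /\
    d v + d w = a v * t w + t v * a w.
  apply: coord_inj; rewrite !rmorphD !rmorphM -thE.
  transitivity (Y v + Y w).
    by rewrite (coordE (Y v)) (coordE (Y w)) -/(b v) -/(b w) -/(d v) -/(d w); ring.
  by rewrite adjXY (coordE (X v)) (coordE (X w)) -/(a v) -/(a w) -/(t v) -/(t w); ring.
have [dv|dv] := eqVneq (d v) (t v * a v);
  have [dw|dw] := eqVneq (d w) (t w * a w) => //; last first.
  (* With a common [t], the second equation makes the two values of d - t a opposite, and they are
     nonzero. *)
  case=> tE; move: sum_d; rewrite -tE => sum_d.
  have -> : d w - t v * a w = - (d v - t v * a v).
    have -> : d w = a v * t v + t v * a w - d v by rewrite -sum_d; ring.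
    by ring.
  rewrite half_opp; first by case: (half _).
  by apply: neq_opp; rewrite // subr_eq0.
case; apply: h_proper.
  apply/eqP => -[av tv betav]; apply: (XY_inj v0 w0 av tv).
    by move: betav; rewrite /beta av tv => /addrI/oppr_inj/(mulfI E2).
  by rewrite dv dw av tv.
(* Putting d = t a at both ends into the second equation makes it factor: the edge keeps [a] or
   [t]. *)
have : (a v - a w) * (t v - t w) = 0.
  by move: sum_d; rewrite dv dw => /eqP; rewrite -subr_eq0 => /eqP <-; ring.
have beta_sum : beta v + beta w = (a v - a w) ^+ 2 + m * (t v - t w) ^+ 2.
  have -> : beta v + beta w = a v ^+ 2 + m * t v ^+ 2 + a w ^+ 2 + m * t w ^+ 2
      - 2%:R * (b v + b w) by rewrite /beta; ring.
  by rewrite sum_b; ring.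
move/eqP; rewrite mulf_eq0 !subr_eq0 => /orP[] /eqP eq_vw; [right | left].
  by rewrite beta_sum eq_vw; split=> //; ring.
by rewrite beta_sum eq_vw; split=> //; ring.
Qed.

Local Close Scope ring_scope.

Lemma chi_ER_le (F : finFieldType) (p r : nat) :
  prime p -> odd p -> 0 < r -> #|F| = p ^ (2 * r) ->
  exists l M : nat, [/\ chi_ER F <= 2 * p ^ r + M, p ^ r <= 2 ^ (6 * l)
    & l * M <= 71 * p ^ r].
Proof.
move=> pr_p odd_p r_gt0 oF.
have [E [iota [m [th [re [im [oE m0 thE coordE coord_inj]]]]]]] :=
  quadratic_subfield pr_p odd_p r_gt0 oF.
have [l [K [i [kappa [Bad [[/andP[l_gt0 le_l] le_exp] i_lt le_K le_Bad sep]]]]]] :=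
  separated_exists pr_p odd_p r_gt0 oE.
have odd_pX n : odd (p ^ n) by rewrite oddX odd_p orbT.
have [j j2] : exists j : F, (j ^+ 2 = -1)%R.
  apply: (@sqrt_opp1_ex F (p ^ r)) => //.
    by rewrite -(exp1n r) ltn_exp2r // prime_gt1.
  by rewrite oF mul2n -addnn expnD.
(* 71 = 8 * 4 + 8 * 4 + 7, from the bounds on [l * K], [l * #|Bad|] and [l]. *)
exists l, (8 * K + 8 * #|Bad| + 7); rewrite -oE; split=> //.
  have oddF : odd #|F| by rewrite oF.
  have oddE : odd #|E| by rewrite oE.
  by have := chi_ER_separated oddF oddE j2 m0 thE coordE coord_inj i_lt sep; rewrite !addnA.
by move: le_K le_Bad le_l; move: #|Bad| #|E| => nB nE; rewrite !mulnDr; lia.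
Qed.

(** * Passage to real numbers *)

Lemma INR_expn (m n : nat) : INR (m ^ n) = pow (INR m) n.
Proof. by elim: n => [|n IHn] //; rewrite expnS mult_INR IHn. Qed.

Lemma ln_INR_le (s l : nat) : 0 < s -> s <= 2 ^ l -> Rle (ln (INR s)) (INR l).
Proof.
move=> s_gt0 /leP/le_INR; rewrite INR_expn => le_s.
have s_pos : Rlt R0 (INR s) by apply/lt_0_INR/ltP.
apply: (Rle_trans _ (ln (pow (INR 2) l))).
  by case: le_s => [lt_s | ->]; [left; apply: ln_increasing | right].
rewrite ln_pow; last by apply/lt_0_INR/ltP.
have ln2 : Rle (ln (INR 2)) 1.
  rewrite -[X in Rle _ X]ln_exp; left; apply: ln_increasing; first by apply/lt_0_INR/ltP.
  by have := exp_ineq1 1; rewrite [INR 2]/=; lra.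
have := pos_INR l; nra.
Qed.

Theorem theorem1p1 :
  exists C : R, Rlt R0 C /\
    forall (p r : nat) (F : finFieldType),
      prime p -> odd p -> (1 <= r)%N -> #|F| = (p ^ (2 * r))%N ->
      Rle (INR (chi_ER F))
          (Rplus (Rmult (INR 2) (sqrt (INR #|F|)))
                 (Rdiv (Rmult C (sqrt (INR #|F|))) (ln (INR #|F|)))).
Proof.
(* 852 = 71 * 12: with s = sqrt q, log q = 2 log s <= 12 l and l M <= 71 s. *)
exists (INR 852); split; first by apply/lt_0_INR/ltP.
move=> p r F pr_p odd_p r_gt0 oF.
have [l [M [le_chi le_exp le_M]]] := chi_ER_le pr_p odd_p r_gt0 oF.
have s_gt1 : 1 < p ^ r by rewrite -(exp1n r) ltn_exp2r // prime_gt1.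
rewrite oF mul2n -addnn expnD mult_INR sqrt_square; last exact: pos_INR.
move: (p ^ r) s_gt1 le_chi le_exp le_M => s s_gt1 le_chi le_exp le_M.
have s_pos : Rlt 1 (INR s) by apply: (lt_INR 1); apply/ltP.
have ln_pos : Rlt 0 (ln (INR s)) by rewrite -ln_1; apply: ln_increasing; lra.
have ln_le : Rle (ln (INR s)) (Rmult 6 (INR l)).
  have := ln_INR_le (ltnW s_gt1) le_exp; rewrite mult_INR.
  by have -> : INR 6 = IZR 6 by rewrite INR_IZR_INZ.
have {}le_M : Rle (Rmult (INR l) (INR M)) (Rmult 71 (INR s)).
  have -> : IZR 71 = INR 71 by rewrite INR_IZR_INZ.
  by rewrite -!mult_INR; apply/le_INR/leP.
have {}le_chi : Rle (INR (chi_ER F)) (Rplus (Rmult (INR 2) (INR s)) (INR M)).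
  by rewrite -mult_INR -plus_INR; apply/le_INR/leP.
rewrite ln_mult; [|lra|lra].
apply: Rle_trans le_chi _; apply: Rplus_le_compat_l.
apply: (Rmult_le_reg_r (Rplus (ln (INR s)) (ln (INR s)))); first lra.
have M_pos := pos_INR M.
have -> : INR 852 = IZR 852 by rewrite INR_IZR_INZ.
rewrite /Rdiv Rmult_assoc Rinv_l; last lra.
nra.
Qed.
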